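(* Let $n\ge 1$, let $\lambda>0$ and $\phi>0$ be constants, and let the boundary layer be $S_\phi=\{\mathbf{x}\in\mathbb{R}^n : |s(\tilde{\mathbf{x}})|\le\phi\}$. Then, once inside $S_\phi$ (that is, if for some $t_0\ge 0$ one has $|s(\tilde{\mathbf{x}}(t))|\le\phi$ for all $t\ge t_0$), the tracking error vector exponentially converges to the closed region $$\Phi=\left\{\mathbf{x}\in\mathbb{R}^n : |s(\tilde{\mathbf{x}})|\le\phi \text{ and } |\tilde{x}^{(i)}|\le\zeta_i\lambda^{i-n+1}\phi,\ i=0,1,\ldots,n-1\right\},$$ where $$\zeta_0=1,\qquad \zeta_i=1+\sum_{j=0}^{i-1}\binom{i}{j}\zeta_j\quad\text{for } i=1,2,\ldots,n-1.$$
   Context: Here $x$ is the scalar output of an $n$-th order system with state vector $\mathbf{x}=[x,\dot{x},\ldots,x^{(n-1)}]$, and $\mathbf{x}_d=[x_d,\dot{x}_d,\ldots,x_d^{(n-1)}]$ is the desired trajectory; $x^{(i)}$ denotes the $i$-th time derivative. The tracking error is $\tilde{x}=x-x_d$ and the tracking error vector is $\tilde{\mathbf{x}}=\mathbf{x}-\mathbf{x}_d=[\tilde{x},\dot{\tilde{x}},\ldots,\tilde{x}^{(n-1)}]$, a function of time $t\in[0,\infty)$. The function $s$ is $$s(\tilde{\mathbf{x}})=\left(\frac{d}{dt}+\lambda\right)^{n-1}\tilde{x}=\sum_{i=0}^{n-1}\binom{n-1}{i}\lambda^{i}\,\tilde{x}^{(n-1-i)}.$$ Both $S_\phi$ and $\Phi$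 are conditions on the tracking error vector $\tilde{\mathbf{x}}$. Exponential convergence of the tracking error vector to $\Phi$ means that there exist constants $C\ge 0$ and $\alpha>0$ such that the Euclidean distance from $\tilde{\mathbf{x}}(t)$ to the set of error vectors satisfying the inequalities defining $\Phi$ is at most $Ce^{-\alpha (t-t_0)}$ for all $t\ge t_0$. *)

(* Defs.v *)
From HB Require Import structures.
From mathcomp Require Import all_boot all_order all_algebra.
From mathcomp Require Import all_classical all_reals all_analysis.

Set Implicit Arguments.
Unset Strict Implicit.
Unset Printing Implicit Defensive.

Import Order.TTheory GRing.Theory Num.Theory.
Import numFieldNormedType.Exports.

Local Open Scope classical_set_scope.
Local Open Scope ring_scope.

(* Trajectories are functions of time in [0, +oo[. They are represented by
   total functions R -> R whose values at negative times are never used: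
   difference quotients only involve points of A, so the derivative at the
   endpoint 0 is one-sided. The value of derive_on is meaningful only under
   derivable_on (lim returns a default value otherwise). *)
Section derivative_on.
Context {R : realType}.

Definition diff_quotient (f : R -> R) (t u : R) : R := (f u - f t) / (u - t).

Definition derivable_on (A : set R) (f : R -> R) (t : R) : Prop :=
  cvg (diff_quotient f t @ within A t^').

Definition derive_on (A : set R) (f : R -> R) (t : R) : R :=
  lim (diff_quotient f t @ within A t^').

Definition nderive_on (A : set R) (i : nat) (f : R -> R) : R -> R :=
  iter i (derive_on A) f.

Definition nderivable_on (A : set R) (k : nat) (f : R -> R) : Prop :=
  forall (i : nat) (t : R), (i < k)%N -> A t ->
    derivable_on A (nderive_on A i f) t.

Definition time : set R := [set t | 0 <= t].

End derivative_on.

Section tracking.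
Context {R : realType} (n : nat).

Definition state_vector (x : R -> R) (t : R) : 'rV[R]_n :=
  \row_(i < n) nderive_on time i x t.

Definition error_vector (x xd : R -> R) (t : R) : 'rV[R]_n :=
  state_vector x t - state_vector xd t.

(* (d/dt + lambda)^(n-1) applied to the error, expanded as a linear form in the
   error vector e; the entry of index rev_ord i is the derivative of order
   n - 1 - i. *)
Definition sliding (lambda : R) (e : 'rV[R]_n) : R :=
  \sum_(i < n) 'C(n.-1, i)%:R * lambda ^+ i * e ord0 (rev_ord i).

Definition boundary_layer (lambda phi : R) : set 'rV[R]_n :=
  [set e | `|sliding lambda e| <= phi].

(* The norm that the library puts on matrices is the maximum norm. *)
Definition euclidean_norm (v : 'rV[R]_n) : R :=
  Num.sqrt (\sum_(i < n) v ord0 i ^+ 2).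

(* Extended-real infimum: the distance to the empty set is +oo. *)
Definition euclidean_dist_to (A : set 'rV[R]_n) (v : 'rV[R]_n) : \bar R :=
  ereal_inf [set (euclidean_norm (v - a))%:E | a in A].

Definition exp_converges_to (t0 : R) (v : R -> 'rV[R]_n) (A : set 'rV[R]_n) :
    Prop :=
  exists C alpha : R, [/\ 0 <= C, 0 < alpha &
    forall t : R, t0 <= t ->
      (euclidean_dist_to A (v t) <= (C * expR (- alpha * (t - t0)))%:E)%E].

End tracking.

(* Course-of-values recursion: zeta_seq k = [:: zeta 0; ...; zeta k.-1]. *)
Fixpoint zeta_seq (k : nat) : seq nat :=
  if k is m.+1 then
    rcons (zeta_seq m) (1 + \sum_(j < m) 'C(m, j) * nth 0 (zeta_seq m) j)%N
  else [::].

Definition zeta (i : nat) : nat := nth 0%N (zeta_seq i.+1) i.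

Lemma size_zeta_seq k : size (zeta_seq k) = k.
Proof. by elim: k => //= k IHk; rewrite size_rcons IHk. Qed.

Lemma nth_zeta_seq k j : (j < k)%N -> nth 0%N (zeta_seq k) j = zeta j.
Proof.
elim: k => // k IHk; rewrite ltnS leq_eqVlt => /predU1P[-> //|ltjk].
by rewrite /= nth_rcons size_zeta_seq ltjk IHk.
Qed.

Lemma zeta0 : zeta 0 = 1%N.
Proof. by rewrite /zeta /= big_ord0. Qed.

Lemma zetaE i : zeta i = (1 + \sum_(j < i) 'C(i, j) * zeta j)%N.
Proof.
rewrite {1}/zeta /= nth_rcons size_zeta_seq ltnn eqxx; congr (1 + _)%N.
by apply: eq_bigr => j _; rewrite nth_zeta_seq.
Qed.

Definition error_region {R : realType} (n : nat) (lambda phi : R) :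
    set 'rV[R]_n :=
  [set e | `|sliding lambda e| <= phi /\
    forall i : 'I_n,
      `|e ord0 i| <= (zeta i)%:R * lambda ^ (i%:Z - n%:Z + 1) * phi].

(* Main.v *)
Require Import Defs.
From HB Require Import structures.
From mathcomp Require Import all_boot all_order all_algebra.
From mathcomp Require Import all_classical all_reals all_analysis.
From mathcomp Require Import ring lra zify.

(** Write [e i] for the error derivative of order [i], put m = n - 1, and let
[filtered e k] be (d/dt + lambda)^k applied to the error, so that
[filtered e m] is the sliding variable s. The cascade of first-order filters

  (d/dt + lambda) (filtered e k) = filtered e k.+1,   k < m,

links s to the error. Such a filter divides an asymptotic bound of its input by
lambda, and if alpha < lambda it keeps transients of order exp (- alpha t)
([first_order_exp_bounded]). Going down the cascade from |s| <= phi therefore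
bounds [filtered e k] by phi lambda^(k - m) up to an exponentially small term
([filtered_exp_bounded]).

The binomial formula of [filtered e i] has leading term [e i], so that [e i] is
[filtered e i] minus a combination of the [e j] with j < i. Going up in [i],
the bounds obey exactly the recurrence of zeta, which yields
|e i| <= zeta_i lambda^(i - m) phi up to an exponentially small term
([error_exp_bounded]).

Hence |e i| <= (1 + d) b_i, where the b_i > 0 are the sides of the box in Phi
and d = D exp (- alpha (t - t0)). The point of Phi close to the error vector has
to lie both in the box and in the slab |s| <= phi, so projecting onto the box is
not enough; but the slab is stable under contraction towards 0, so that the
error vector divided by 1 + d belongs to Phi. It lies at distance at most d
times the Euclidean norm of (b_i) from the error vector ([dist_error_region]).

No integral is used: the derivative of order m need not be continuous, and the
filter estimate is obtained from the monotonicity of a function whose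
derivative has a constant sign. *)

Set Implicit Arguments.
Unset Strict Implicit.
Unset Printing Implicit Defensive.

Import Order.TTheory GRing.Theory Num.Theory.
Import numFieldNormedType.Exports.

Local Open Scope classical_set_scope.
Local Open Scope ring_scope.

(** * One-sided derivatives on the time half-line *)

Section derivative_along.
Context {R : realType}.
Implicit Types (f g df dg : R -> R) (t l : R).

(** At an interior time the restriction to [time] is invisible: this is what
turns the relative derivative into a two-sided one. *)
Lemma cvg_add_within_time t : 0 < t ->
  h + t @[h --> (0 : R)^'] --> within time t^'.
Proof.
move=> t_gt0 A nA.
have {}nA : \forall u \near t, u != t -> time u -> A u by exact: nA.
have {nA} /nbhs0P : \forall u \near t, u != t -> A u.
  apply: (filterS2 _ _ nA (lt_nbhsr t_gt0)) => u {}nA u_gt0 ut.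
  by apply: nA => //; exact: ltW.
apply: filterS => h /= nA h_neq0; rewrite addrC; apply: nA.
by rewrite -subr_eq0 addrAC subrr add0r.
Qed.

Lemma diff_quotient_is_derive f t l : 0 < t ->
  diff_quotient f t @ within time t^' --> l -> is_derive t 1 f l.
Proof.
move=> t_gt0 fl.
have ql : h^-1 *: ((f \o shift t) (h *: (1 : R)) - f t) @[h --> 0^'] --> l.
  have := cvg_comp _ _ (cvg_add_within_time t_gt0) fl.
  apply: cvg_trans; apply: near_eq_cvg; near=> h => /=.
  by rewrite /diff_quotient /GRing.scale /= mulr1 addrK mulrC.
by apply: DeriveDef; [apply/cvg_ex; exists l | exact: cvg_lim].
Unshelve. all: by end_near. Qed.

Lemma at_right_within_time t : 0 <= t -> t^'+ `=>` within time t^'.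
Proof.
move=> t_ge0 A nA.
have {}nA : \forall u \near t, u != t -> time u -> A u by exact: nA.
suff : \forall u \near t, t < u -> A u by [].
apply: filterS nA => u nA tu; apply: nA; first by rewrite gt_eqF.
by rewrite /time /= ltW// (le_lt_trans t_ge0).
Qed.

Lemma diff_quotient_right_continuous f t l : 0 <= t ->
  diff_quotient f t @ within time t^' --> l -> f u @[u --> t^'+] --> f t.
Proof.
move=> t_ge0 fl.
have ql : diff_quotient f t u @[u --> t^'+] --> l.
  by apply: cvg_trans fl => A; apply: (at_right_within_time t_ge0).
have idt : u - t @[u --> t^'+] --> (0 : R).
  rewrite -(subrr t); apply: cvgB; last exact: cvg_cst.
  exact: cvg_at_right_filter cvg_id.
have : diff_quotient f t u * (u - t) + f t @[u --> t^'+] --> l * 0 + f t.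
  by apply: cvgD; [exact: cvgM | exact: cvg_cst].
rewrite mulr0 add0r; apply: cvg_trans; apply: near_eq_cvg.
near=> u => /=; rewrite /diff_quotient -mulrA mulVf ?mulr1 ?subrK//.
by rewrite subr_eq0 gt_eqF.
Unshelve. all: by end_near. Qed.

(** The hypotheses of the mean value theorem on every [t0, t]: differentiability
in the interior, but only continuity at [t0]. The derivative at [t0] itself
must be left out, since it is one-sided when [t0] is 0. *)
Definition has_derivative_from (t0 : R) f df : Prop :=
  f t @[t --> t0^'+] --> f t0 /\ forall t, t0 < t -> is_derive t 1 f (df t).

Lemma derivable_on_has_derivative_from t0 f : 0 <= t0 ->
  (forall t, 0 <= t -> derivable_on time f t) ->
  has_derivative_from t0 f (derive_on time f).
Proof.
move=> t0_ge0 fd; split.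
  exact: diff_quotient_right_continuous t0_ge0 (fd _ t0_ge0).
move=> t /(le_lt_trans t0_ge0) t_gt0.
exact: diff_quotient_is_derive t_gt0 (fd _ (ltW t_gt0)).
Qed.

Lemma has_derivative_fromB t0 f g df dg :
  has_derivative_from t0 f df -> has_derivative_from t0 g dg ->
  has_derivative_from t0 (fun t => f t - g t) (fun t => df t - dg t).
Proof.
move=> [fc fd] [gc gd]; split; first exact: cvgB.
by move=> t t0t; have ? := fd t t0t; have ? := gd t t0t; apply: is_deriveB.
Qed.

Lemma has_derivative_fromN t0 f df :
  has_derivative_from t0 f df ->
  has_derivative_from t0 (fun t => - f t) (fun t => - df t).
Proof.
move=> [fc fd]; split; first exact: cvgN.
by move=> t t0t; have ? := fd t t0t; apply: is_deriveN.
Qed.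

Lemma has_derivative_from_lin t0 k (a : 'I_k -> R) (f df : 'I_k -> R -> R) :
  (forall i, has_derivative_from t0 (f i) (df i)) ->
  has_derivative_from t0 (fun t => \sum_(i < k) a i * f i t)
                         (fun t => \sum_(i < k) a i * df i t).
Proof.
move=> fP; split.
  apply: cvg_big => [|i _]; first exact: add_continuous.
  by apply: cvgM; [exact: cvg_cst | have [] := fP i].
move=> t t0t.
have -> : (fun t => \sum_(i < k) a i * f i t) = \sum_(i < k) a i *: f i.
  by apply/funext => s; rewrite fct_sumE.
apply: is_derive_sum => i; have [_ /(_ t t0t) fi] := fP i.
exact: is_deriveZ.
Qed.

End derivative_along.

(** * First-order filters *)

(** The bound z satisfies z' + lambda z >= B + C exp (- alpha (t - t0)) and
z(t0) >= y(t0), so it dominates the solution y: the difference y - z multiplied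
by the integrating factor exp (lambda (t - t0)) is nonincreasing and starts
nonpositive. At alpha = lambda the filter would resonate and produce a term
t exp (- lambda t). *)
Lemma first_order_ub {R : realType} (t0 lambda alpha B C : R) (y w : R -> R) :
  0 < alpha -> alpha < lambda -> 0 <= B -> 0 <= C ->
  has_derivative_from t0 y (fun t => w t - lambda * y t) ->
  (forall t, t0 <= t -> w t <= B + C * expR (- alpha * (t - t0))) ->
  forall t, t0 <= t ->
    y t <= B / lambda +
           (`|y t0| + C / (lambda - alpha)) * expR (- alpha * (t - t0)).
Proof.
move=> a_gt0 al B_ge0 C_ge0 [y_rc y_der] w_ub t t0t.
have l_gt0 : 0 < lambda by lra.
have C'_ge0 : 0 <= C / (lambda - alpha) by rewrite divr_ge0// subr_ge0 ltW.
set D := `|y t0| + _.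
pose g s := expR (lambda * (s - t0)) *
  (y s - B / lambda - D * expR (- alpha * (s - t0))).
have g_der s : t0 < s -> is_derive s 1 g (expR (lambda * (s - t0)) *
    (w s - B - D * (lambda - alpha) * expR (- alpha * (s - t0)))).
  move=> t0s; have ys := y_der s t0s.
  have expd (c : R) : is_derive s 1 (fun s => expR (c * (s - t0)))
      (c * expR (c * (s - t0))).
    have d1 : is_derive s 1 (fun s => c *: (s - t0)) c.
      by apply: is_derive_eq; rewrite subr0 /GRing.scale/= mulr1.
    have := @is_derive1_comp _ expR (fun s => c * (s - t0)) s _ _
      (is_derive_expR _) d1.
    by rewrite mulrC.
  have e1 := expd lambda; have e2 := expd (- alpha).
  have e3 : is_derive s 1
      (fun s => y s - B / lambda - D * expR (- alpha * (s - t0)))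
      (w s - lambda * y s - 0 - D * (- alpha * expR (- alpha * (s - t0)))).
    apply: is_deriveB; exact: is_deriveZ.
  apply: is_derive_eq (is_deriveM e1 e3) _.
  rewrite /GRing.scale /=.
  field; lra.
have g_noninc : g t <= g t0.
  apply: (@ler0_derive1_nincry _ g t0) => //.
  - by move=> s; rewrite in_itv/= andbT => /g_der; case.
  - move=> s; rewrite in_itv/= andbT => t0s.
    have := g_der s t0s => ?; rewrite derive1E derive_val.
    rewrite mulr_ge0_le0 ?expR_ge0// -addrA -opprD subr_le0.
    apply: le_trans (w_ub s (ltW t0s)) _; rewrite lerD2l ler_wpM2r ?expR_ge0//.
    rewrite mulrDl divfK ?lerDr ?mulr_ge0 //; lra.
  - apply/continuous_within_itvcyP; split.
      move=> s; rewrite in_itv/= andbT => /g_der gs.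
      by apply: differentiable_continuous; apply/derivable1_diffP.
    have expc (c : R) :
        expR (c * (s - t0)) @[s --> t0^'+] --> expR (c * (t0 - t0)).
      apply: cvg_at_right_filter.
      apply: (@continuous_comp _ _ _ (fun s => c * (s - t0)) expR).
        apply: cvgM; first exact: cvg_cst.
        by apply: cvgB; [exact: cvg_id | exact: cvg_cst].
      exact: continuous_expR.
    apply: cvgM; first exact: expc.
    apply: cvgB; first by apply: cvgB => //; exact: cvg_cst.
    apply: cvgM; [exact: cvg_cst | exact: expc].
have g0 : g t0 <= 0.
  rewrite /g subrr !mulr0 expR0 mul1r mulr1.
  have := ler_norm (y t0).
  have : 0 <= B / lambda by rewrite divr_ge0// ltW.
  rewrite /D; lra.
have := le_trans g_noninc g0.
by rewrite /g pmulr_rle0 ?expR_gt0// -addrA -opprD subr_le0.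
Qed.

Section exp_bounds.
Context {R : realType} (t0 alpha : R).

Definition exp_bounded (B : R) (f : R -> R) : Prop :=
  exists2 C, 0 <= C &
    forall t, t0 <= t -> `|f t| <= B + C * expR (- alpha * (t - t0)).

Lemma exp_boundedB A B f g : exp_bounded A f -> exp_bounded B g ->
  exp_bounded (A + B) (fun t => f t - g t).
Proof.
move=> [C C_ge0 fC] [D D_ge0 gD]; exists (C + D) => [|t t0t].
  exact: addr_ge0.
apply: le_trans (ler_normB _ _) _; rewrite mulrDl addrACA.
by apply: lerD; [exact: fC | exact: gD].
Qed.

Lemma exp_bounded_lin k (a B : 'I_k -> R) (f : 'I_k -> R -> R) :
  (forall i, 0 <= a i) -> (forall i, exp_bounded (B i) (f i)) ->
  exp_bounded (\sum_(i < k) a i * B i) (fun t => \sum_(i < k) a i * f i t).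
Proof.
move=> a_ge0 /(_ _)/cid2-/all_sig2[C C_ge0 fC].
exists (\sum_(i < k) a i * C i) => [|t t0t].
  by apply: sumr_ge0 => i _; apply: mulr_ge0.
rewrite mulr_suml -big_split/=; apply: le_trans (ler_norm_sum _ _ _) _.
apply: ler_sum => i _; rewrite normrM (ger0_norm (a_ge0 i)) -mulrA -mulrDr.
by rewrite ler_wpM2l// fC.
Qed.

(** The lower bound is the upper bound for [- y], which solves the same equation
with input [- w]. *)
Lemma first_order_exp_bounded lambda B y w :
  0 < alpha -> alpha < lambda -> 0 <= B ->
  has_derivative_from t0 y (fun t => w t - lambda * y t) ->
  exp_bounded B w -> exp_bounded (B / lambda) y.
Proof.
move=> a_gt0 al B_ge0 yw [C C_ge0 wC].
have l_gt0 : 0 < lambda := lt_trans a_gt0 al.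
exists (`|y t0| + C / (lambda - alpha)) => [|t t0t].
  by rewrite addr_ge0// divr_ge0// subr_ge0 ltW.
rewrite ler_norml lerNl; apply/andP; split; last first.
  apply: first_order_ub yw _ t t0t => // s t0s.
  by apply: le_trans (wC s t0s); exact: ler_norm.
rewrite -(normrN (y t0)).
apply: (@first_order_ub _ _ _ _ _ _ (fun s => - y s) (fun s => - w s)) => //;
  last first.
  by move=> s t0s; apply: le_trans (wC s t0s); rewrite -normrN; exact: ler_norm.
rewrite (_ : (fun s => - w s - lambda * - y s) =
  fun s => - (w s - lambda * y s)).
  exact: has_derivative_fromN.
by apply/funext => s; ring.
Qed.

End exp_bounds.

(** * The cascade from the sliding variable to the error *)

Section filtered.
Context {R : realType} (lambda : R).
Implicit Types (e : nat -> R -> R).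

(** This is (d/dt + lambda)^k applied to [e 0], when [e i.+1] is the derivative
of [e i]. *)
Definition filtered e (k : nat) (t : R) : R :=
  \sum_(j < k.+1) 'C(k, j)%:R * lambda ^+ (k - j) * e j t.

Lemma filtered_recr e i t :
  e i t = filtered e i t - \sum_(j < i) 'C(i, j)%:R * lambda ^+ (i - j) * e j t.
Proof.
rewrite /filtered big_ord_recr/= binn subnn expr0 !mul1r.
by rewrite addrAC subrr add0r.
Qed.

(** Pascal's rule: the left-hand side is the formal time derivative of
[filtered e k], so this is (d/dt + lambda) (filtered e k) = filtered e k.+1. *)
Lemma filteredS e k t :
  \sum_(j < k.+1) 'C(k, j)%:R * lambda ^+ (k - j) * e j.+1 t =
  filtered e k.+1 t - lambda * filtered e k t.
Proof.
rewrite /filtered [in RHS]big_ord_recl/= bin0 subn0 mul1r.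
have -> : lambda * (\sum_(j < k.+1) 'C(k, j)%:R * lambda ^+ (k - j) * e j t) =
    lambda ^+ k.+1 * e 0 t +
    \sum_(j < k.+1) 'C(k, j.+1)%:R * lambda ^+ (k - j) * e j.+1 t.
  rewrite [in RHS]big_ord_recr/= bin_small// !mul0r addr0.
  rewrite big_ord_recl/= bin0 subn0 mul1r mulrDr mulrA -exprS; congr (_ + _).
  rewrite mulr_sumr; apply: eq_bigr => j _.
  rewrite /bump/= add1n -(subnSK (ltn_ord j)) exprS; ring.
rewrite opprD addrACA subrr add0r -sumrB; apply: eq_bigr => j _.
by rewrite /bump/= add1n subSS binS natrD -!mulrA -mulrBl addrAC subrr add0r.
Qed.

Lemma has_derivative_from_filtered t0 m e k : (k < m)%N ->
  (forall i, (i < m)%N -> has_derivative_from t0 (e i) (e i.+1)) ->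
  has_derivative_from t0 (filtered e k)
    (fun t => filtered e k.+1 t - lambda * filtered e k t).
Proof.
move=> km eP.
have := @has_derivative_from_lin _ t0 k.+1
  (fun j => 'C(k, j)%:R * lambda ^+ (k - j)) (fun j => e j) (fun j => e j.+1).
rewrite (_ : (fun t => \sum_(j < k.+1) _ * e j.+1 t) =
  (fun t => filtered e k.+1 t - lambda * filtered e k t)); last first.
  by apply/funext => t; exact: filteredS.
by apply=> j; apply: eP; apply: leq_ltn_trans km; rewrite -ltnS.
Qed.

(** Downward induction on [k]: each filter of the cascade divides the bound of
its input by lambda. *)
Lemma filtered_exp_bounded t0 alpha m e B :
  0 < alpha -> alpha < lambda -> 0 <= B ->
  (forall i, (i < m)%N -> has_derivative_from t0 (e i) (e i.+1)) ->
  exp_bounded t0 alpha (B * lambda ^+ m) (filtered e m) ->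
  forall k, (k <= m)%N -> exp_bounded t0 alpha (B * lambda ^+ k) (filtered e k).
Proof.
move=> a_gt0 al B_ge0 eP em k km.
have l_gt0 : 0 < lambda := lt_trans a_gt0 al.
have := subnK km; move: (m - k)%N => d; elim: d k {km} => [k|d IHd k kdm].
  by rewrite add0n => ->.
have k_lt_m : (k < m)%N by rewrite -kdm addSn ltnS leq_addl.
rewrite -[X in exp_bounded _ _ X](mulfK (lt0r_neq0 l_gt0)) -(mulrA B) -exprSr.
apply: first_order_exp_bounded (IHd _ _) => //.
- by rewrite mulr_ge0// exprn_ge0// ltW.
- exact: has_derivative_from_filtered k_lt_m eP.
- by rewrite addnS -addSn.
Qed.

(** Strong induction on [i], solving the formula of [filtered e i] for its
leading term [e i]. Once B lambda^i is factored out, the term 1 in the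
recurrence of zeta is the bound of [filtered e i], and the sum is that of the
[e j] with j < i. *)
Lemma error_exp_bounded t0 alpha m e B : 0 <= lambda ->
  (forall k, (k <= m)%N ->
     exp_bounded t0 alpha (B * lambda ^+ k) (filtered e k)) ->
  forall i, (i <= m)%N ->
    exp_bounded t0 alpha ((zeta i)%:R * (B * lambda ^+ i)) (e i).
Proof.
move=> l_ge0 yP; elim/ltn_ind => i IH im.
rewrite (_ : e i = (fun t => filtered e i t -
  \sum_(j < i) 'C(i, j)%:R * lambda ^+ (i - j) * e j t)); last first.
  by apply/funext => t; exact: filtered_recr.
rewrite (_ : _%:R * _ = B * lambda ^+ i +
  \sum_(j < i) 'C(i, j)%:R * lambda ^+ (i - j) *
    ((zeta j)%:R * (B * lambda ^+ j))); last first.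
  rewrite zetaE natrD natr_sum mulrDl mul1r mulr_suml; congr (_ + _).
  apply: eq_bigr => j _; rewrite natrM.
  have -> : lambda ^+ i = lambda ^+ (i - j) * lambda ^+ j.
    by rewrite -exprD subnK// ltnW.
  by ring.
apply: exp_boundedB; first exact: yP.
apply: (@exp_bounded_lin _ t0 alpha i (fun j => 'C(i, j)%:R * lambda ^+ (i - j))
  _ (fun j => e j)) => j; first by rewrite mulr_ge0// exprn_ge0.
by apply: IH => //; exact: leq_trans (ltnW (ltn_ord j)) im.
Qed.

End filtered.

(** * Distance to the error region *)

Section distance.
Context {R : realType} (n : nat).
Implicit Types (v a : 'rV[R]_n) (A : set 'rV[R]_n).

Lemma euclidean_normZ (c : R) v : 0 <= c ->
  euclidean_norm (c *: v) = c * euclidean_norm v.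
Proof.
move=> c_ge0; rewrite /euclidean_norm.
under eq_bigr do rewrite mxE exprMn.
by rewrite -mulr_sumr sqrtrM ?sqr_ge0// sqrtr_sqr ger0_norm.
Qed.

Lemma le_euclidean_norm v (b : 'I_n -> R) : (forall i, `|v ord0 i| <= b i) ->
  euclidean_norm v <= Num.sqrt (\sum_(i < n) b i ^+ 2).
Proof.
move=> vb; apply: ler_wsqrtr; apply: ler_sum => i _.
by rewrite -real_normK ?num_real// lerXn2r ?nnegrE// (le_trans _ (vb i)).
Qed.

Lemma slidingZ lambda (c : R) v :
  sliding lambda (c *: v) = c * sliding lambda v.
Proof.
by rewrite /sliding mulr_sumr; apply: eq_bigr => i _; rewrite mxE; ring.
Qed.

Lemma euclidean_dist_to_le A v a : A a ->
  (euclidean_dist_to A v <= (euclidean_norm (v - a))%:E)%E.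
Proof. by move=> Aa; apply: ereal_inf_lbound; exists a. Qed.

Lemma euclidean_dist_to_scaled A a (d : R) : 0 <= d -> A a ->
  (euclidean_dist_to A ((1 + d) *: a) <= (d * euclidean_norm a)%:E)%E.
Proof.
move=> d_ge0 Aa; apply: le_trans (euclidean_dist_to_le _ Aa) _.
by rewrite scalerDl scale1r addrAC subrr add0r euclidean_normZ.
Qed.

Definition error_bound (lambda phi : R) (i : 'I_n) : R :=
  (zeta i)%:R * lambda ^ (i%:Z - n%:Z + 1) * phi.

(** The point of the region is v / (1 + d): contraction towards 0 brings v back
into the box without leaving the boundary layer. *)
Lemma dist_error_region lambda phi (d : R) v :
  0 <= d -> boundary_layer lambda phi v ->
  (forall i, `|v ord0 i| <= (1 + d) * error_bound lambda phi i) ->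
  (euclidean_dist_to (error_region lambda phi) v <=
     (d * Num.sqrt (\sum_(i < n) error_bound lambda phi i ^+ 2))%:E)%E.
Proof.
move=> d_ge0 v_layer v_bound.
have d1_gt0 : 0 < 1 + d by rewrite ltr_wpDr.
have scaled (u : R) : `|(1 + d)^-1 * u| = `|u| / (1 + d).
  by rewrite normrM gtr0_norm ?invr_gt0// mulrC.
pose a := (1 + d)^-1 *: v.
have a_bound i : `|a ord0 i| <= error_bound lambda phi i.
  by rewrite mxE scaled ler_pdivrMr// mulrC.
have a_region : error_region lambda phi a.
  split=> //; rewrite slidingZ scaled.
  by apply: le_trans v_layer; rewrite ler_piMr// invf_le1// lerDl.
rewrite -[v](@scalerKV _ _ (1 + d)) ?gt_eqF//.
apply: le_trans (euclidean_dist_to_scaled d_ge0 a_region) _.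
by rewrite lee_fin ler_wpM2l// le_euclidean_norm.
Qed.

End distance.

Theorem theorem2 (R : realType) (n : nat) (n_ge1 : (1 <= n)%N)
    (lambda phi : R) (lambda_gt0 : 0 < lambda) (phi_gt0 : 0 < phi)
    (x xd : R -> R)
    (x_derivable : nderivable_on time n.-1 x)
    (xd_derivable : nderivable_on time n.-1 xd)
    (t0 : R) (t0_ge0 : 0 <= t0)
    (inside : forall t : R, t0 <= t ->
       boundary_layer lambda phi (error_vector n x xd t)) :
  exp_converges_to t0 (error_vector n x xd) (error_region (n := n) lambda phi).
Proof.
case: n n_ge1 x_derivable xd_derivable inside => // m _ /= x_der xd_der inside.
pose e i t : R := nderive_on time i x t - nderive_on time i xd t.
have e_der i : (i < m)%N -> has_derivative_from t0 (e i) (e i.+1).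
  move=> im; apply: has_derivative_fromB;
    apply: derivable_on_has_derivative_from => // t t_ge0.
    exact: x_der.
  exact: xd_der.
have eE t i : error_vector m.+1 x xd t ord0 i = e i t by rewrite !mxE.
have slidingE t :
    sliding lambda (error_vector m.+1 x xd t) = filtered lambda e m t.
  rewrite /sliding (reindex_inj rev_ord_inj)/=; apply: eq_bigr => j _.
  by rewrite rev_ordK eE subSS bin_sub// -ltnS.
pose B := phi / lambda ^+ m.
have B_gt0 : 0 < B by rewrite divr_gt0// exprn_gt0.
pose b := @error_bound _ m.+1 lambda phi.
have bE (i : 'I_m.+1) : (zeta i)%:R * (B * lambda ^+ i) = b i.
  have -> : b i = (zeta i)%:R * lambda ^ (i%:Z - m%:Z) * phi.
    by congr (_ * lambda ^ _ * _); lia.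
  by rewrite expfzDr ?gt_eqF// -exprnN -exprnP /B; ring.
have b_gt0 i : 0 < b i.
  rewrite -bE mulr_gt0//; first by rewrite ltr0n zetaE.
  by rewrite mulr_gt0// exprn_gt0.
(* Any rate strictly between 0 and lambda would do. *)
pose alpha := lambda / 2.
have a_gt0 : 0 < alpha by rewrite divr_gt0.
have al : alpha < lambda by rewrite /alpha; lra.
have s_bounded : exp_bounded t0 alpha (B * lambda ^+ m) (filtered lambda e m).
  exists 0 => // t t0t; rewrite mul0r addr0 -slidingE divfK ?inside//.
  by rewrite gt_eqF// exprn_gt0.
have e_bounded (i : 'I_m.+1) : exp_bounded t0 alpha (b i) (e i).
  rewrite -bE; apply: (@error_exp_bounded _ lambda _ _ m); first exact: ltW.
    exact: filtered_exp_bounded a_gt0 al (ltW B_gt0) e_der s_bounded.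
  by rewrite -ltnS ltn_ord.
have /all_sig2[C C_ge0 eC] := fun i => cid2 (e_bounded i).
(* A single relative excess D for all the coordinates. *)
pose D := \sum_i C i / b i.
have Cb_ge0 i : 0 <= C i / b i by rewrite divr_ge0// ltW.
have D_ge0 : 0 <= D by apply: sumr_ge0.
exists (D * Num.sqrt (\sum_(i < m.+1) b i ^+ 2)), alpha; split => //.
  by rewrite mulr_ge0// sqrtr_ge0.
move=> t t0t; rewrite mulrAC; apply: dist_error_region.
- by rewrite mulr_ge0// expR_ge0.
- exact: inside.
- move=> i; rewrite eE; apply: le_trans (eC i t t0t) _.
  rewrite mulrDl mul1r lerD2l mulrAC ler_wpM2r ?expR_ge0//.
  rewrite -ler_pdivrMr// /D (bigD1 i)//= lerDl.
  by apply: sumr_ge0.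
Qed.
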